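(* For every $n\ge 3$: $s_n^0(123,231,312)=s_n^2(123,231,312)=\frac n2\left(1-I_{n\text{ odd}}\right)$, $s_n^1(123,231,312)=n\left(1-I_{n\text{ even}}\right)$, and $s_n^k(123,231,312)=0$ for all $3\le k\le n$.
   Context: $S_n$ denotes the set of permutations of $\{1,\dots,n\}$ written in one-line notation $\pi=\pi_1\pi_2\cdots\pi_n$. For $\alpha\in S_m$, $\pi\in S_n$ contains the pattern $\alpha$ if there are indices $i_1<i_2<\dots<i_m$ such that $\pi_{i_1}\pi_{i_2}\cdots\pi_{i_m}$ is order-isomorphic to $\alpha$; otherwise $\pi$ avoids $\alpha$. For a set $T$ of patterns, $S_n^k(T)$ is the set of $\pi\in S_n$ that have exactly $k$ fixed points (indices $i$ with $\pi_i=i$) and avoid every pattern in $T$; $s_n^k(T)=|S_n^k(T)|$. The braces around $T$ are omitted, e.g. $s_n^k(123,231,312)=s_n^k(\{123,231,312\})$. For a statement $P$, $I_P=1$ if $P$ is true and $I_P=0$ if $P$ is false. *)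

(* Defs.v *)
From mathcomp Require Import all_boot all_order all_fingroup all_algebra.

Set Implicit Arguments.
Unset Strict Implicit.
Unset Printing Implicit Defensive.

(* Positions and values of a permutation in 'S_n run over 0, ..., n - 1 instead
   of 1, ..., n; [one_line] shifts back to the usual one-line notation. *)
Definition one_line (n : nat) (pi : 'S_n) : seq nat :=
  [seq (pi i : nat).+1 | i <- enum 'I_n].

(* [f] lists the chosen indices i_1 < ... < i_m. *)
Definition contains (m n : nat) (alpha : 'S_m) (pi : 'S_n) : bool :=
  [exists f : {ffun 'I_m -> 'I_n},
     [forall i : 'I_m, forall j : 'I_m, (i < j) ==> (f i < f j)] &&
     [forall i : 'I_m, forall j : 'I_m,
        (pi (f i) < pi (f j)) == (alpha i < alpha j)]].

Definition avoids (m n : nat) (alpha : 'S_m) (pi : 'S_n) : bool :=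
  ~~ contains alpha pi.

(* Patterns of one set may have different lengths. *)
Definition pattern : Type := {m : nat & 'S_m}.

Definition mk_pattern (m : nat) (alpha : 'S_m) : pattern :=
  Tagged (fun m : nat => 'S_m) alpha.

Definition avoids_all (n : nat) (T : seq pattern) (pi : 'S_n) : bool :=
  all (fun a : pattern => avoids (tagged a) pi) T.

Definition fixed_points (n : nat) (pi : 'S_n) : {set 'I_n} :=
  [set i | pi i == i].

Definition Snk (n k : nat) (T : seq pattern) : {set 'S_n} :=
  [set pi : 'S_n | (#|fixed_points pi| == k) && avoids_all T pi].

Definition snk (n k : nat) (T : seq pattern) : nat := #|Snk n k T|.

(* In 'I_3, addition is modulo 3. *)
Definition p123 : 'S_3 := 1%g.
Definition p231 : 'S_3 := perm (@GRing.addrI 'I_3 (inord 1)).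
Definition p312 : 'S_3 := perm (@GRing.addrI 'I_3 (inord 2)).

Lemma one_line_p123 : one_line p123 = [:: 1; 2; 3].
Proof. by rewrite /one_line !enum_ordSl enum_ord0 /= !perm1. Qed.

Lemma one_line_p231 : one_line p231 = [:: 2; 3; 1].
Proof. by rewrite /one_line !enum_ordSl enum_ord0 /= !permE /= !inordK. Qed.

Lemma one_line_p312 : one_line p312 = [:: 3; 1; 2].
Proof. by rewrite /one_line !enum_ordSl enum_ord0 /= !permE /= !inordK. Qed.

(* Main.v *)
Require Import Defs.
From mathcomp Require Import all_boot all_order all_fingroup all_algebra.
From mathcomp Require Import zify.
Import GRing.Theory.
Local Open Scope ring_scope.

(** The three patterns are the cyclic rotations of 123, so avoiding all of
    them says that [pi] sends every increasing triple of positions to a triple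
    of values that runs backwards around the cycle Z/n: [pi] reverses the
    cyclic order ([avoids_all_cyclic]).  The only such permutations are the
    reflections i |-> c - i of Z/n ([avoids_all_reflection]): the values at two
    adjacent positions i, i + 1 must be cyclically adjacent, because the
    position l of the value pi(i) - 1 would otherwise give a triple
    (i, i + 1, l) whose values pi(i), pi(i + 1), pi(i) - 1 run forwards.

    Fixed points of the reflection are the solutions of 2i = c in Z/n, that is,
    2i = c or 2i = c + n in the integers with 0 <= i < n.  Each of the two
    equations has one solution if its right-hand side is even and none
    otherwise ([card_fixed_reflection]).  For odd n exactly one of c and c + n
    is even, so all n reflections have one fixed point; for even n they have
    the same parity, so the n/2 even c give two fixed points and the n/2 odd c
    give none. *)

Definition cyclic3 (a b c : nat) : bool :=
  [|| (a < b < c)%N, (b < c < a)%N | (c < a < b)%N].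

(** Three of the six comparisons determine the relative order, since the values
    of a permutation are distinct. *)
Lemma contains3P (n : nat) (alpha : 'S_3) (pi : 'S_n) :
  let a (x : nat) : nat := alpha (inord x) in
  reflect (exists i j k : 'I_n,
             [/\ (i < j < k)%N, (pi i < pi j)%N = (a 0 < a 1)%N,
                 (pi j < pi k)%N = (a 1 < a 2)%N
               & (pi i < pi k)%N = (a 0 < a 2)%N])
          (contains alpha pi).
Proof.
move=> a; apply: (iffP existsP) => [[f /andP[/forallP fmono /forallP fpat]]|].
  have lt (x y : 'I_3) : (x < y)%N -> (f x < f y)%N.
    by move: (fmono x) => /forallP/(_ y)/implyP.
  have pat (x y : 'I_3) : (pi (f x) < pi (f y))%N = (alpha x < alpha y)%N.
    by move: (fpat x) => /forallP/(_ y)/eqP.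
  exists (f (inord 0)), (f (inord 1)), (f (inord 2)).
  by split; rewrite ?pat // !lt ?inordK.
case=> i [j] [k] [/andP[ltij ltjk] pij pjk pik].
pose f := [ffun x : 'I_3 => nth i [:: i; j; k] x].
have neq_perm m (s : 'S_m) (x y : 'I_m) : x != y -> (s x : nat) <> s y.
  by move=> neq_xy /val_inj/perm_inj eq_xy; rewrite eq_xy eqxx in neq_xy.
have neq_pi (x y : 'I_n) : (x < y)%N -> (pi x : nat) <> pi y.
  by move=> lt_xy; apply: neq_perm; apply: contraTneq lt_xy => ->; rewrite ltnn.
have neq_a (x y : nat) : (x < y < 3)%N -> a x <> a y.
  move=> /andP[lt_xy lt_y3]; apply: neq_perm.
  by rewrite -val_eqE /= !inordK ?neq_ltn ?lt_xy // (ltn_trans lt_xy).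
have ltik := ltn_trans ltij ltjk.
have nij := neq_pi _ _ ltij; have njk := neq_pi _ _ ltjk.
have nik := neq_pi _ _ ltik.
have a01 := neq_a 0%N 1%N isT; have a12 := neq_a 1%N 2%N isT.
have a02 := neq_a 0%N 2%N isT.
have aE (x : 'I_3) : (alpha x : nat) = a x by rewrite /a inord_val.
exists f; apply/andP; split; apply/forallP=> x; apply/forallP=> y.
  by case: x y => [[|[|[|x]]] ltx] [[|[|[|y]]] lty] //=; rewrite !ffunE.
rewrite !aE !ffunE.
case: x y => [[|[|[|x]]] ltx] [[|[|[|y]]] lty] //=; apply/eqP; lia.
Qed.

Lemma avoids_all_cyclic (n : nat) (pi : 'S_n) :
  reflect (forall i j k : 'I_n, (i < j < k)%N ->
             ~~ cyclic3 (pi i) (pi j) (pi k))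
    (avoids_all [:: mk_pattern p123; mk_pattern p231; mk_pattern p312] pi).
Proof.
rewrite /avoids_all /= andbT /avoids.
have v123 x : (x < 3)%N -> (p123 (inord x) : nat) = x.
  by move=> lt_x3; rewrite perm1 inordK.
have v231 x : (x < 3)%N -> (p231 (inord x) : nat) = ((1 + x) %% 3)%N.
  by move=> lt_x3; rewrite permE /= !inordK.
have v312 x : (x < 3)%N -> (p312 (inord x) : nat) = ((2 + x) %% 3)%N.
  by move=> lt_x3; rewrite permE /= !inordK.
apply: (iffP idP) => [/and3P[no123 no231 no312] i j k ltijk|acyc].
  apply/negP => /or3P[] /andP[lt1 lt2].
  - case/negP: no123; apply/contains3P; exists i, j, k.
    by rewrite !v123 //; split=> //=; lia.
  - case/negP: no312; apply/contains3P; exists i, j, k.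
    by rewrite !v312 //; split=> //=; lia.
  - case/negP: no231; apply/contains3P; exists i, j, k.
    by rewrite !v231 //; split=> //=; lia.
have neq_pi (x y : 'I_n) : (x < y)%N -> (pi x : nat) <> pi y.
  by move=> + /val_inj/perm_inj eq_xy; rewrite eq_xy ltnn.
apply/and3P; split; apply/negP => /contains3P[i] [j] [k] [ltijk];
  move: (acyc i j k ltijk); case/andP: (ltijk) => ltij ltjk;
  have := neq_pi _ _ ltij; have := neq_pi _ _ ltjk;
  have := neq_pi _ _ (ltn_trans ltij ltjk);
  rewrite /cyclic3 ?v123 ?v231 ?v312 //=; lia.
Qed.

Definition reflection {m : nat} (c : 'I_m.+1) : 'S_m.+1 :=
  perm (can_inj (subKr c)).

Lemma val_reflection (m : nat) (c i : 'I_m.+1) :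
  (reflection c i : nat) = (if (i <= c)%N then c - i else c + m.+1 - i)%N.
Proof.
rewrite permE /= modnDmr; have := ltn_ord c; have := ltn_ord i.
case: (leqP i c) => [le_ic lt_i lt_c | lt_ci lt_i lt_c].
  by rewrite addnBA 1?ltnW // addnC -addnBA // modnDl modn_small; lia.
by rewrite modn_small; lia.
Qed.

Lemma reflection_inj (m : nat) : injective (@reflection m).
Proof.
move=> c d /(congr1 (fun s : 'S_m.+1 => s ord0)).
by rewrite !permE !subr0.
Qed.

Lemma val_ord_pred {m : nat} (v : 'I_m.+1) :
  (ord_pred v : nat) = (if v == 0%N :> nat then m else v.-1)%N.
Proof.
rewrite /=; case: v => [[|v] lt_v] /=; first by rewrite modn_small.
by rewrite modnDr modn_small // ltnW.
Qed.

(** If [pi j] is not the cyclic predecessor of [pi i], that predecessor is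
    taken at a third position [l].  The positions i, i + 1, l are in cyclic
    order wherever [l] lies, and so are their values, since every other value
    comes between [pi i] and its predecessor when counting upwards from
    [pi i]. *)
Lemma acyclic_succ (m : nat) (pi : 'S_m.+1) (i j : 'I_m.+1) :
  (forall i j k : 'I_m.+1, (i < j < k)%N -> ~~ cyclic3 (pi i) (pi j) (pi k)) ->
  (j = i.+1 :> nat) -> pi j = ord_pred (pi i).
Proof.
move=> acyc eq_j; pose l := (pi^-1)%g (ord_pred (pi i)).
have pil : pi l = ord_pred (pi i) by rewrite permKV.
have [<- //|neq_lj] := eqVneq l j.
have vpil : (pi l : nat) = _ := etrans (congr1 val pil) (val_ord_pred (pi i)).
have neq_pi (x y : 'I_m.+1) : (x : nat) <> y -> (pi x : nat) <> pi y.
  by move=> neq_xy /val_inj/perm_inj eq_xy; case: neq_xy; rewrite eq_xy.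
have lj : (l : nat) <> j by move=> /val_inj eq_lj; rewrite eq_lj eqxx in neq_lj.
have li : (l : nat) <> i.
  move=> /val_inj eq_li; move: vpil; rewrite eq_li.
  by have := ltn_ord j; case: eqP; lia.
have := neq_pi _ _ lj; have := neq_pi _ _ li.
have := neq_pi i j; have := ltn_ord (pi i); have := ltn_ord (pi j).
have := acyc l i j; have := acyc i j l.
by move: vpil; rewrite /cyclic3; case: eqP; lia.
Qed.

Lemma avoids_all_reflection (m : nat) (pi : 'S_m.+1) :
  avoids_all [:: mk_pattern p123; mk_pattern p231; mk_pattern p312] pi
  = (pi \in codom (@reflection m)).
Proof.
apply/avoids_all_cyclic/codomP => [acyc | [c ->] i j k lt_ijk]; last first.
  rewrite !val_reflection /cyclic3.
  by have := ltn_ord c; have := ltn_ord k; do 3?case: ifP; lia.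
exists (pi ord0); apply/permP => -[i lt_i]; apply: val_inj.
rewrite /= val_reflection /=.
elim: i lt_i => [|i IHi] lt_i.
  by rewrite subn0 (bool_irrelevance lt_i (ltn0Sn m)).
rewrite (@acyclic_succ _ _ (Ordinal (ltnW lt_i))) // val_ord_pred IHi.
by have := ltn_ord (pi ord0); do 3?case: ifP; lia.
Qed.

Lemma card_double_eq (n a : nat) :
  (a < n.*2)%N -> #|[set i : 'I_n | i.*2 == a]| = ~~ odd a.
Proof.
move=> lt_a; case: (boolP (odd a)) => [odd_a | even_a] /=.
  apply: eq_card0 => i; rewrite inE; apply: contraTF odd_a => /eqP <-.
  by rewrite odd_double.
have lt_h : (a./2 < n)%N by rewrite ltn_half_double.
rewrite -(cards1 (Ordinal lt_h)); apply: eq_card => i.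
rewrite !inE -val_eqE /=; lia.
Qed.

Lemma card_fixed_reflection (m : nat) (c : 'I_m.+1) :
  #|fixed_points (reflection c)| = (~~ odd c + ~~ odd (c + m.+1))%N.
Proof.
have lt_c := ltn_ord c.
have disj : [set i : 'I_m.+1 | (i.*2 == c)%N]
            :&: [set i : 'I_m.+1 | (i.*2 == c + m.+1)%N] = set0.
  by apply/setP => i; rewrite !inE; lia.
rewrite -(card_double_eq m.+1 c) -?(card_double_eq m.+1 (c + m.+1)); try lia.
rewrite -cardsUI disj cards0 addn0; apply: eq_card => i.
rewrite !inE -val_eqE /= val_reflection.
by have := ltn_ord i; case: ifP; lia.
Qed.

Lemma snk_reflections (m k : nat) :
  snk m.+1 k [:: mk_pattern p123; mk_pattern p231; mk_pattern p312]
  = #|[set c : 'I_m.+1 | (~~ odd c + ~~ odd (c + m.+1) == k)%N]|.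
Proof.
rewrite -(card_imset _ (@reflection_inj m)); apply: eq_card => pi.
rewrite !inE avoids_all_reflection.
apply/andP/imsetP => [[fix_k /codomP[c def_pi]] | [c + ->]].
  by exists c; rewrite // inE -card_fixed_reflection -def_pi.
by rewrite inE -card_fixed_reflection => fix_k; rewrite codom_f.
Qed.

Lemma card_odd_ord (n : nat) : #|[set c : 'I_n | odd c]| = n./2.
Proof.
rewrite -sum1_card (eq_bigl (fun c : 'I_n => odd c)); last first.
  by move=> c; rewrite inE.
rewrite -(big_mkord odd (fun=> 1%N)).
elim: n => [|n IHn]; first by rewrite big_nil.
rewrite big_mkcond big_nat_recr //= -big_mkcond IHn uphalf_half addnC.
by case: (odd n).
Qed.

Lemma snk_odd (n k : nat) : odd n ->
  snk n k [:: mk_pattern p123; mk_pattern p231; mk_pattern p312]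
  = if k == 1%N then n else 0%N.
Proof.
case: n => // m odd_n; rewrite snk_reflections.
case: eqP => [-> | neq_k].
  by rewrite -[RHS]card_ord; apply: eq_card => c; rewrite !inE; lia.
by apply: eq_card0 => c; rewrite !inE; lia.
Qed.

Lemma snk_even (n k : nat) : (0 < n)%N -> ~~ odd n ->
  snk n k [:: mk_pattern p123; mk_pattern p231; mk_pattern p312]
  = if (k == 0%N) || (k == 2%N) then n./2 else 0%N.
Proof.
case: n => // m _ even_n; rewrite snk_reflections.
case: eqP => [-> | neq0] /=.
  by rewrite -[RHS](card_odd_ord m.+1); apply: eq_card => c; rewrite !inE; lia.
case: eqP => [-> | neq2]; last by apply: eq_card0 => c; rewrite !inE; lia.
have := cardsC [set c : 'I_m.+1 | odd c].
rewrite card_odd_ord card_ord => sum_n.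
have -> : [set c : 'I_m.+1 | (~~ odd c + ~~ odd (c + m.+1) == 2)%N]
          = ~: [set c : 'I_m.+1 | odd c].
  by apply/setP => c; rewrite !inE; lia.
by apply: (@addnI m.+1./2); rewrite sum_n [RHS]addnn even_halfK.
Qed.

Theorem theorem3p4 (n : nat) (hn : (3 <= n)%N) :
  let T := [:: mk_pattern p123; mk_pattern p231; mk_pattern p312] in
  [/\ (snk n 0 T)%:R = n%:R / 2 * (1 - (odd n)%:R) :> rat,
      (snk n 2 T)%:R = n%:R / 2 * (1 - (odd n)%:R) :> rat,
      (snk n 1 T)%:R = n%:R * (1 - (~~ odd n)%:R) :> rat
    & forall k : nat, (3 <= k <= n)%N -> snk n k T = 0%N].
Proof.
move=> T; rewrite /T; case: (boolP (odd n)) => [odd_n | even_n].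
  rewrite !snk_odd //= !(subrr, subr0, mulr0, mulr1).
  by split=> // k /andP[le3k _]; rewrite snk_odd //; case: eqP le3k => // ->.
rewrite !snk_even ?(ltn_trans _ hn) //= !(subrr, subr0, mulr0, mulr1).
have half_n : (n./2)%:R = n%:R / 2 :> rat.
  by rewrite -[n in RHS](even_halfK even_n) -muln2 natrM mulfK.
split=> // k /andP[le3k _]; rewrite snk_even ?(ltn_trans _ hn) //.
by move: k le3k => [|[|[|k]]].
Qed.
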